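(* If $X$ is a Hausdorff topological space, then the Smyth powerspace $\mathcal{Q}^*_v(X)$ is strongly well-filtered.
   Context: A subset of a topological space is saturated if it is an intersection of open subsets. $\mathcal{Q}^*_v(X)$ denotes the set of all nonempty compact saturated subsets of $X$, equipped with the upper Vietoris topology, i.e. the topology generated by the basic open sets $\square U:=\{K: K\subseteq U\}$, $U$ ranging over the open subsets of $X$. A $T_0$ space $Y$ is strongly well-filtered if for any filtered family $(K_i)_{i\in I}$ of compact saturated subsets of $Y$ (i.e. a nonempty family such that for all $i,j\in I$ there is $k\in I$ with $K_k\subseteq K_i\cap K_j$), any compact saturated subset $K$ of $Y$, and any open subset $U$ of $Y$: if $\bigcap_{i\in I}(K_i\cap K)\subseteq U$, then $K_i\cap K\subseteq U$ for some $i\in I$. *)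

(* Defs.v *)
From HB Require Import structures.
From mathcomp Require Import all_boot all_classical topology.

Set Implicit Arguments.
Unset Strict Implicit.
Unset Printing Implicit Defensive.

Local Open Scope classical_set_scope.

Definition saturated {X : topologicalType} (A : set X) : Prop :=
  exists2 F : set (set X), F `<=` open & A = \bigcap_(U in F) U.

(* Points of the Smyth powerspace. The proof fields are propositions, so two
   elements with the same [smyth_set] are equal by [Prop_irrelevance]. *)
Record smyth (X : topologicalType) := Smyth {
  smyth_set :> set X ;
  smyth_nonempty : smyth_set !=set0 ;
  smyth_compact : compact smyth_set ;
  smyth_saturated : saturated smyth_set }.

HB.instance Definition _ (X : topologicalType) := gen_eqMixin (smyth X).
HB.instance Definition _ (X : topologicalType) := gen_choiceMixin (smyth X).

Definition box {X : topologicalType} (U : set X) : set (smyth X) :=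
  [set K | smyth_set K `<=` U].

Lemma box_cover (X : topologicalType) :
  \bigcup_(U in [set U : set X | open U]) box U = setT.
Proof. by apply/seteqP; split=> // K _; exists setT => //; exact: openT. Qed.

Lemma box_join (X : topologicalType) (U V : set X) (K : smyth X) :
  [set U : set X | open U] U -> [set U : set X | open U] V ->
  box U K -> box V K ->
  exists W, [/\ [set U : set X | open U] W, box W K & box W `<=` box U `&` box V].
Proof.
move=> oU oV KU KV; exists (U `&` V); split.
- exact: openI.
- by move=> x Kx; split; [exact: KU|exact: KV].
- by move=> L LUV; split=> x /LUV [].
Qed.

(* Upper Vietoris topology: the sets [box U], U open, form a base (not only a
   subbase) since [box U `&` box V = box (U `&` V)]. *)
HB.instance Definition _ (X : topologicalType) :=
  isBaseTopological.Build (smyth X) (@box_cover X) (@box_join X).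

Lemma open_smythE (X : topologicalType) (W : set (smyth X)) :
  open W <-> exists2 F : set (set X), F `<=` open & W = \bigcup_(U in F) box U.
Proof.
split.
  by case=> F sF FW; exists F => // U FU; have /set_mem := sF _ (mem_set FU).
case=> F sF ->; exists F => // U FU; exact/mem_set/sF/set_mem.
Qed.

(* Filtered for reverse inclusion; [I] is required to be nonempty. *)
Definition filtered_family {Y I : Type} (K : I -> set Y) : Prop :=
  inhabited I /\ forall i j, exists k, K k `<=` K i `&` K j.

Definition strongly_well_filtered (Y : topologicalType) : Prop :=
  kolmogorov_space Y /\
  forall (I : Type) (K_ : I -> set Y) (K U : set Y),
    filtered_family K_ ->
    (forall i, compact (K_ i) /\ saturated (K_ i)) ->
    compact K -> saturated K -> open U ->
    \bigcap_i (K_ i `&` K) `<=` U ->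
    exists i, K_ i `&` K `<=` U.

(* Main.v *)
Require Import Defs.
From mathcomp Require Import all_boot all_classical topology.

(** The heart of the proof is that, over a Hausdorff [X], the set of limits of a
    convergent proper filter [F] on the Smyth powerspace has a least element
    for inclusion: the intersection of all limits is again a nonempty compact
    set and again a limit ([cvg_least_smyth]).  Intuitively, a point missing
    from some limit [D] can be separated from [D], so the sets in [F] eventually
    stay away from a neighbourhood of it; finitely many such neighbourhoods
    suffice, since one limit is compact.

    Given this, suppose that no [K_ i `&` K] is contained in the open set [U].
    The sets [K_ i `&` K `\` U] form a filter base; refine it to an ultrafilter.
    By compactness it has a limit in every [K_ i] and one in [K].  The least
    limit [C] lies below all of them, and saturated sets of compact sets are
    closed under shrinking, so [C] belongs to every [K_ i] and to [K], hence to
    [U].  But [U] is then a neighbourhood of [C] disjoint from a member of the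
    ultrafilter.

    The T0 axiom holds because [X] is T1: if [x] lies in [L] but not in [K],
    the box of the complement of [x] contains [K] and not [L].  T1 also makes
    every subset of [X] saturated, so that compactness and nonemptiness are all
    that must be checked for the least limit. *)

Local Open Scope classical_set_scope.

Lemma smyth_inj (X : topologicalType) (K L : smyth X) :
  smyth_set K = smyth_set L -> K = L.
Proof.
case: K L => [K K0 Kc Ks] [L L0 Lc Ls] /= KL; subst L.
by rewrite (Prop_irrelevance K0 L0) (Prop_irrelevance Kc Lc)
  (Prop_irrelevance Ks Ls).
Qed.

Lemma open_box (X : topologicalType) (U : set X) : open U -> open (box U).
Proof.
move=> oU; apply/open_smythE; exists [set U]; first by move=> _ ->.
by rewrite bigcup_set1.
Qed.

Lemma nbhs_smythP (X : topologicalType) (K : smyth X) (W : set (smyth X)) :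
  nbhs K W <-> exists U : set X, [/\ open U, K `<=` U & box U `<=` W].
Proof.
split; rewrite nbhsE.
  move=> [V [/open_smythE[F oF ->] [U FU KU]] VW].
  by exists U; split=> [||L LU]; [exact: oF|exact: KU|apply: VW; exists U].
by move=> [U [oU KU UW]]; exists (box U) => //; split=> //; exact: open_box.
Qed.

Lemma cvg_smythP (X : topologicalType) (F : set_system (smyth X))
    (K : smyth X) : Filter F ->
  (F --> K) <-> (forall U : set X, open U -> K `<=` U -> F (box U)).
Proof.
move=> FF; split=> [FK U oU KU|FK W /nbhs_smythP[U [oU KU UW]]].
  by apply: FK; apply/nbhs_smythP; exists U; split.
by apply: (filterS UW); exact: FK.
Qed.

(** The specialization order of the Smyth powerspace is reverse inclusion, so
    saturated sets are closed under shrinking. *)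
Lemma saturated_smythS (X : topologicalType) (A : set (smyth X))
    (K L : smyth X) : saturated A -> L `<=` K -> A K -> A L.
Proof.
move=> [F oF ->] LK AK W FW.
have : nbhs K W by apply: open_nbhs_nbhs; split; [exact: oF|exact: AK].
by move=> /nbhs_smythP[U [_ KU]]; apply=> x /LK /KU.
Qed.

(** Local-to-uniform principle: on a compact set, a property of points that
    holds locally for small members of a filter, and passes to smaller members,
    holds everywhere for a single member.  This replaces the extraction of a
    finite subcover followed by a finite intersection of members of the
    filter. *)
Lemma compact_filter_uniform (X : topologicalType) (T : Type)
    (F : set_system T) (R : set T -> X -> Prop) (A : set X) :
  ProperFilter F -> compact A ->
  (forall G H x, G `<=` H -> R H x -> R G x) ->
  (forall x, A x -> exists2 G, F G & nbhs x (R G)) ->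
  exists2 G, F G & A `<=` R G.
Proof.
move=> FF /compact_near_coveringP cA Rmono locR.
apply/(@near_powerset_filter_fromP _ F (fun G => A `<=` R G)).
  by move=> G H GH RH x Ax; apply: Rmono GH _; exact: RH.
apply: cA => x /locR[G FG xG].
exists (R G, [set H | H `<=` G]) => /=.
  by split=> //; exact: small_set_sub.
by move=> [y H] /= [Ry HG]; exact: Rmono HG Ry.
Qed.

Section hausdorff.
Variables (X : topologicalType) (hX : hausdorff_space X).
Implicit Types (F : set_system (smyth X)) (C D E K L : smyth X).

Lemma open_setC1 (x : X) : open (~` [set x]).
Proof.
by apply/closed_openC/accessible_closed_set1/hausdorff_accessible.
Qed.

Lemma saturatedT1 (A : set X) : saturated A.
Proof.
exists [set ~` [set x] | x in ~` A]; first by move=> _ [x _ <-]; exact: open_setC1.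
apply/seteqP; split=> [y Ay _ [x nAx <-] yx|y Hy]; first by apply: nAx; rewrite -yx.
apply: contrapT => nAy; exact: (Hy (~` [set y]) (ex_intro2 _ _ y nAy erefl)).
Qed.

Lemma kolmogorov_smyth : kolmogorov_space (smyth X).
Proof.
have sep K L x : smyth_set L x -> ~ smyth_set K x ->
    box (~` [set x]) \in nbhs K /\ L \in ~` box (~` [set x]).
  move=> Lx nKx; split; rewrite inE; last by move=> /(_ x Lx); exact.
  apply/nbhs_smythP; exists (~` [set x]); split=> //; first exact: open_setC1.
  by move=> y Ky yx; apply: nKx; rewrite -yx.
move=> K L /eqP KL.
have [LK|/existsNP[x /not_implyP[Lx nKx]]] := pselect (L `<=` K); last first.
  by exists (box (~` [set x])); left; exact: sep.
have [KL'|/existsNP[x /not_implyP[Kx nLx]]] := pselect (K `<=` L); last first.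
  by exists (box (~` [set x])); right; exact: sep.
by case: KL; apply: smyth_inj; apply/seteqP; split.
Qed.

(** The Hausdorff property separates [x] from each point of [A]; compactness
    lets one neighbourhood [N] of [x] serve for all of them, and [W] is then the
    exterior of [N]. *)
Lemma compact_point_separated (A : set X) (x : X) : compact A -> ~ A x ->
  exists W : set X, [/\ open W, A `<=` W & nbhs x (~` W)].
Proof.
move=> cA nAx.
have [||N xN AN] := @compact_filter_uniform _ _ (nbhs x)
    (fun N a => nbhs a (~` N)) A _ cA.
- by move=> G H a GH; apply: filterS => b nHb /GH.
- move=> a Aa.
  have /eqP ax : a <> x by move=> ax; apply: nAx; rewrite -ax.
  move: hX; rewrite open_hausdorff => /(_ _ _ ax)[[V N] /=].
  move=> [/set_mem Va /set_mem Nx] [oV oN /eqP VN0].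
  exists N; first exact: open_nbhs_nbhs.
  apply: (filterS _ (open_nbhs_nbhs (conj oV Va))) => b Vb.
  apply: (filterS _ (open_nbhs_nbhs (conj oV Vb))) => c Vc Nc.
  by rewrite -[False]/(set0 c) -VN0.
- exists (interior (~` N)); split=> //; first exact: open_interior.
  by apply: filterS xN => y Ny /interior_subset.
Qed.

(** This contains both the closure of limits under finite intersections, where
    disjoint compact sets are separated, and under filtered intersections, where
    an open set containing the intersection contains a member of the family. *)
Lemma cvg_bigcap_smyth F E (U : set X) : ProperFilter F -> F --> E ->
  open U -> \bigcap_(D in [set D | F --> D]) smyth_set D `<=` U -> F (box U).
Proof.
move=> FF FE oU CU.
pose R (G : set (smyth X)) (x : X) :=
  nbhs x [set y | forall K, G K -> smyth_set K y -> U y].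
have [||G FG EG] := @compact_filter_uniform _ _ F R E _ (@smyth_compact _ E).
- move=> G H x GH; apply: filterS => y HU K /GH; exact: HU.
- move=> x Ex.
  have [Ux|nUx] := pselect (U x).
    exists setT; first exact: filterT.
    apply: (filterS _ (open_nbhs_nbhs (conj oU Ux))) => y Uy.
    by apply: (filterS _ (open_nbhs_nbhs (conj oU Uy))) => z Uz.
  (* [x] lies outside [U], so some limit [D] misses it; sets close to [D] stay
     away from a neighbourhood of [x]. *)
  have [D FD nDx] : exists2 D, F --> D & ~ smyth_set D x.
    apply: contrapT => nD; apply: nUx; apply: CU => D FD.
    by apply: contrapT => nDx; apply: nD; exists D.
  have [W [oW DW xW]] := compact_point_separated _ _ (@smyth_compact _ D) nDx.
  exists (box W); first by move/cvg_smythP: FD; exact.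
  move/nbhs_interior: xW; apply: filterS => y yW.
  by apply: filterS yW => z nWz K KW /KW.
pose V := interior [set y | forall K, G K -> smyth_set K y -> U y].
have FV : F (box V).
  by move/cvg_smythP: FE; apply; [exact: open_interior|move=> x /EG].
apply: filterS (filterI FG FV) => K [GK KV] x Kx.
by have /interior_subset/(_ K GK Kx) := KV x Kx.
Qed.

(** Nonemptiness of the least limit is the case of the empty open set: every
    member of the powerspace being nonempty, [F] cannot contain [box set0]. *)
Lemma cvg_least_smyth F E : ProperFilter F -> F --> E ->
  exists2 C : smyth X, F --> C & forall D, F --> D -> C `<=` D.
Proof.
move=> FF FE; pose C := \bigcap_(D in [set D | F --> D]) smyth_set D.
have C0 : C !=set0.
  apply/set0P/negP => /eqP C0.
  have /filter_ex[K K0] : F (box set0).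
    by apply: cvg_bigcap_smyth FE _ _; [exact: open0|rewrite -/C C0].
  by have [x /K0] := @smyth_nonempty _ K.
have cC : compact C.
  apply: (@subclosed_compact _ C E); last by move=> x; apply.
    by apply: closed_bigI => D _; apply: compact_closed => //; exact: smyth_compact.
  exact: smyth_compact.
exists (Smyth C0 cC (saturatedT1 C)); last by move=> D FD x; apply.
by apply/cvg_smythP => U oU CU; exact: cvg_bigcap_smyth FE oU CU.
Qed.

End hausdorff.

Theorem corollary3p7 (X : topologicalType) (hX : hausdorff_space X) :
  strongly_well_filtered (smyth X).
Proof.
split; first exact: kolmogorov_smyth.
move=> I K_ K U [[i0] Kdir] K_cs cK sK oU KU; apply: contrapT => noi.
pose B i := K_ i `&` K `\` U.
have B0 i : B i !=set0.
  apply: contrapT => nB; apply: noi; exists i => L KL.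
  by apply: contrapT => nUL; apply: nB; exists L.
have BF : ProperFilter (filter_from setT B).
  apply: filter_from_proper => //; apply: filter_from_filter; first by exists i0.
  move=> i j _ _; have [k Kk] := Kdir i j.
  by exists k => // L [[/Kk[Li Lj] KL] nUL].
have [F [FU BsubF]] := ultraFilterLemma BF.
have FB i : F (B i) by apply: BsubF; exists i.
have lim A : compact A -> F A -> exists2 D, A D & F --> D.
  by rewrite compact_ultra => cA /(cA _ FU)[D [AD FD]]; exists D.
have [E KE FE] : exists2 D, K D & F --> D.
  by apply: lim => //; apply: filterS (FB i0) => L [[]].
have [C FC Cmin] := cvg_least_smyth _ hX _ _ _ FE.
have UC : U C.
  apply: KU => i _; split; last exact: saturated_smythS sK (Cmin _ FE) KE.
  have [ci si] := K_cs i.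
  have [D KD FD] : exists2 D, K_ i D & F --> D.
    by apply: lim => //; apply: filterS (FB i) => L [[]].
  exact: saturated_smythS si (Cmin _ FD) KD.
have FUU : F U by apply: FC; exact: open_nbhs_nbhs.
have /filter_ex[L [UL [_ /(_ UL)]]] : F (U `&` B i0) by exact: filterI.
by [].
Qed.
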